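(* Let $(H;\langle\cdot,\cdot\rangle)$ be an infinite dimensional Hilbert space over the real or complex number field $\mathbb{K}$, $(e_i)_{i\in\mathbb{N}}$ an orthonormal family in $H$, $\boldsymbol\lambda=(\lambda_i)_{i\in\mathbb{N}}\in\ell^2(\mathbb{K})$ and $r>0$ with the property that $$\sum_{i=1}^\infty|\lambda_i|^2>r^2 .$$ If $x\in H$ is such that $$\left\|x-\sum_{i=1}^\infty\lambda_ie_i\right\|\le r,$$ then $$\|x\|^2\le\frac{\left(\sum_{i=1}^\infty\operatorname{Re}[\overline{\lambda_i}\langle x,e_i\rangle]\right)^2}{\sum_{i=1}^\infty|\lambda_i|^2-r^2}\le\frac{\left|\sum_{i=1}^\infty\overline{\lambda_i}\langle x,e_i\rangle\right|^2}{\sum_{i=1}^\infty|\lambda_i|^2-r^2}\le\frac{\sum_{i=1}^\infty|\lambda_i|^2}{\sum_{i=1}^\infty|\lambda_i|^2-r^2}\sum_{i=1}^\infty|\langle x,e_i\rangle|^2$$ and $$0\le\|x\|^2-\sum_{i=1}^\infty|\langle x,e_i\rangle|^2\le\frac{r^2}{\sum_{i=1}^\infty|\lambda_i|^2-r^2}\sum_{i=1}^\infty|\langle x,e_i\rangle|^2 .$$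
   Context: The inner product is linear in its first argument and $\|z\|=\sqrt{\langle z,z\rangle}$. The family $(e_i)_{i\in\mathbb{N}}$ is orthonormal (not assumed complete): $\langle e_i,e_j\rangle=0$ for $i\ne j$ and $\|e_i\|=1$. $\ell^2(\mathbb{K})$ is the space of sequences $(a_i)_{i\in\mathbb{N}}$ in $\mathbb{K}$ with $\sum_{i=1}^\infty|a_i|^2<\infty$; for $\boldsymbol\lambda\in\ell^2(\mathbb{K})$ the series $\sum_{i=1}^\infty\lambda_ie_i$ converges in $H$. *)

(* Defs.v *)
From HB Require Import structures.
From mathcomp Require Export all_boot all_order all_algebra.
From mathcomp Require Export complex.
From mathcomp Require Export all_classical all_reals all_analysis.
Export numFieldNormedType.Exports.

Set Implicit Arguments.
Unset Strict Implicit.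
Unset Printing Implicit Defensive.

Import Order.TTheory GRing.Theory Num.Theory.
Local Open Scope ring_scope.
Local Open Scope classical_set_scope.

Inductive scalar_kind := RealScalars | ComplexScalars.

(* In both cases norms, and hence all inequalities, take their values in the
   field itself. The order of [R[i]] compares complex numbers with the same
   imaginary part, so that [0 < z] forces [z] to be real. *)
Definition scalar (R : realType) (k : scalar_kind) : numFieldType :=
  match k with
  | RealScalars => R : numFieldType
  | ComplexScalars => R[i] : numFieldType
  end.

Definition sconj (R : realType) (k : scalar_kind) :
    {rmorphism scalar R k -> scalar R k} :=
  match k return {rmorphism scalar R k -> scalar R k} with
  | RealScalars => idfun
  | ComplexScalars => @conjc R
  end.

Definition sRe (R : realType) (k : scalar_kind) : scalar R k -> scalar R k :=
  match k return scalar R k -> scalar R k with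
  | RealScalars => fun z => z
  | ComplexScalars => fun z : R[i] => ((complex.Re z)%:C)%C
  end.

Definition ssqrt (R : realType) (k : scalar_kind) : scalar R k -> scalar R k :=
  match k return scalar R k -> scalar R k with
  | RealScalars => fun z : R => Num.sqrt z
  | ComplexScalars => fun z : R[i] => sqrtC z
  end.

(* [{dot H for theta}] is linear in its first argument, [theta]-semilinear in
   the second one, hermitian and positive definite. *)
Definition norm_induced_by (R : realType) (k : scalar_kind)
    (H : normedModType (scalar R k)) (dot : {dot H for sconj R k}) : Prop :=
  forall z : H, `|z| = ssqrt (dot z z).

Definition infinite_dimensional (K : fieldType) (V : lmodType K) : Prop :=
  forall (n : nat) (v : 'I_n -> V),
    exists x : V, forall a : 'I_n -> K, x <> \sum_(i < n) a i *: v i.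

Definition orthonormal_family (R : realType) (k : scalar_kind)
    (H : normedModType (scalar R k)) (dot : {dot H for sconj R k})
    (e : nat -> H) : Prop :=
  (forall i j, i != j -> dot (e i) (e j) = 0) /\ (forall i, `|e i| = 1).

(* Series are summed from index 0, by [limn (series _)] in the norm topology of
   the scalar field or of the space. *)
Definition square_summable (K : numFieldType) (a : nat -> K) : Prop :=
  cvgn (series (fun i => `|a i| ^+ 2)).

(* Main.v *)
Require Import Defs.
Import Order.TTheory GRing.Theory Num.Theory.
Local Open Scope ring_scope.
Local Open Scope classical_set_scope.

(** Put [S] for the sum of the [lambda i *: e i], so that [`|S| ^+ 2 = L], and
    [D := L - r ^+ 2 > 0].  Expanding [`|x - S| ^+ 2 <= r ^+ 2] gives
    [`|x| ^+ 2 + D <= 2 Re (dot x S)], and the arithmetic-geometric mean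
    inequality bounds [4 `|x| ^+ 2 D] by the square of the left-hand side; hence
    [`|x| ^+ 2 <= (Re (dot x S)) ^+ 2 / D] ([reverse_Schwarz]).  This only
    concerns the two vectors [x] and [S]; the orthonormal family enters when the
    series are evaluated.  The inner product is continuous, so [A] is [dot x S]
    ([cvg_dot_series]) and [C] is its real part.  The Cauchy-Schwarz inequality
    for the partial sums of [dot x (e i) *: e i] and [lambda i *: e i] yields
    [`|A| ^+ 2 <= L * B] in the limit ([dot_series_Cauchy_Schwarz]).  The last
    line of the theorem is Bessel's inequality ([Bessel_series_ineq]) and the
    chain of the first three inequalities, since [L / D - 1 = r ^+ 2 / D].

    The two kinds of scalars are told apart only for a few properties of
    conjugation, real part and square root, and for the convergence of bounded
    monotone sequences.  Everything else is done in the field [scalar R k],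
    whose order is partial in the complex case: this is why many terms are shown
    to be real or nonnegative before they are compared, and why limits of
    inequalities are handled through the norm. *)

(** * Real and complex scalars *)

Section Scalars.
Context {R : realType} {k : scalar_kind}.
Implicit Types z w : scalar R k.

Lemma sconjK : involutive (sconj R k).
Proof. by case: k => // z; exact: conjcK. Qed.

Lemma mulr_sconj z : z * sconj R k z = `|z| ^+ 2.
Proof.
case: k z => [z|z] /=; last exact/esym/sqr_normc.
by rewrite real_normK ?num_real.
Qed.

Lemma addr_sconj z : z + sconj R k z = 2 * sRe z.
Proof. by case: k z => [z|z] /=; [rewrite mulr_natl | exact: addcJ]. Qed.

Lemma sRe_is_real z : sRe z \is Num.real.
Proof. by case: k z => [z|z] /=; [exact: num_real | rewrite complex_real]. Qed.

Lemma sqr_ssqrt z : 0 <= z -> ssqrt z ^+ 2 = z.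
Proof. by case: k z => [z|z] /=; [exact: sqr_sqrtr | rewrite sqrtCK]. Qed.

(** Nonnegative complex numbers are real, so the complex case is the real one
    carried along the embedding of [R], which preserves distances. *)
Lemma nondecreasing_bounded_is_cvgn (u : nat -> scalar R k) M :
  (forall n, 0 <= u n) -> {homo u : m n / (m <= n)%N >-> m <= n} ->
  (forall n, u n <= M) -> cvgn u.
Proof.
case: k u M => [u M _ nd ub|u M u0 nd ub].
  by apply: nondecreasing_is_cvgn => //; exists M => _ [n _ <-].
pose v n : R := complex.Re (u n).
have uE n : u n = ((v n)%:C)%C by rewrite RRe_real // ger0_real.
have /cvg_ex[l vl] : cvgn v.
  apply: nondecreasing_is_cvgn.
    by move=> m n /nd; rewrite !uE lecR.
  by exists (complex.Re M) => _ [n _ <-]; have := ub n; rewrite lecE => /andP[].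
apply/cvg_ex; exists (l%:C)%C; apply/cvgrPdist_lt => eps eps0.
(* The radius [eps] is itself a complex number; being positive, it is real. *)
have epsE : eps = ((complex.Re eps)%:C)%C by rewrite RRe_real // gtr0_real.
have Reps0 : 0 < complex.Re eps by rewrite -ltcR -epsE.
move/cvgrPdist_lt : vl => /(_ _ Reps0).
apply: filterS => n; rewrite uE => vn.
by rewrite epsE -rmorphB /= normc_def /= expr0n /= addr0 sqrtr_sqr ltcR.
Qed.

Lemma norm_sconj z : `|sconj R k z| = `|z|.
Proof.
by apply/eqP; rewrite -(@eqrXn2 _ 2) // -!mulr_sconj sconjK mulrC.
Qed.

(** Conjugation fixes the reals because [z * sconj z = `|z| ^+ 2], which is
    [z * z] for a real [z]. *)
Lemma sconj_id z : z \is Num.real -> sconj R k z = z.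
Proof.
move=> zr; have [->|z0] := eqVneq z 0; first by rewrite rmorph0.
by apply: (mulfI z0); rewrite mulr_sconj real_normK.
Qed.

(** This expression makes additivity and continuity of the real part follow from
    those of conjugation. *)
Lemma sRe_half z : sRe z = 2^-1 * (z + sconj R k z).
Proof. by rewrite addr_sconj mulKf // pnatr_eq0. Qed.

Lemma norm_sRe z : `|sRe z| <= `|z|.
Proof.
rewrite -(ler_pM2l (ltr0n _ 2)) -[X in X * `|_|]normr_nat -normrM -addr_sconj.
by rewrite (le_trans (ler_normD _ _)) // norm_sconj mulr_natl.
Qed.

Lemma cvg_sconj (u : nat -> scalar R k) z :
  u n @[n --> \oo] --> z -> sconj R k (u n) @[n --> \oo] --> sconj R k z.
Proof.
move=> /cvgrPdist_lt uz; apply/cvgrPdist_lt => eps /uz.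
by apply: filterS => n; rewrite -rmorphB norm_sconj.
Qed.

Lemma cvg_sRe (u : nat -> scalar R k) z :
  u n @[n --> \oo] --> z -> sRe (u n) @[n --> \oo] --> sRe z.
Proof.
move=> uz; rewrite sRe_half; under eq_fun do rewrite sRe_half.
by apply: cvgM; [exact: cvg_cst | apply: cvgD => //; exact: cvg_sconj].
Qed.

Lemma cvg_series_sRe (u : nat -> scalar R k) l :
  series u n @[n --> \oo] --> l ->
  series (fun i => sRe (u i)) n @[n --> \oo] --> sRe l.
Proof.
move=> /cvg_sRe.
suff -> : series (fun i => sRe (u i)) = (fun n => sRe (series u n)) by [].
apply/funext => n; rewrite sRe_half rmorph_sum -big_split mulr_sumr /=.
by apply: eq_bigr => i _; rewrite sRe_half.
Qed.
End Scalars.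

(** * Limits of inequalities in a partially ordered field *)

Section Limits.
Context {K : numFieldType}.

(** Nonnegative elements are those equal to their norm, and this equation passes
    to the limit because the norm is continuous, whether or not the order is
    total. *)
Lemma cvgn_ge0 (u : nat -> K) l :
  u n @[n --> \oo] --> l -> (forall n, 0 <= u n) -> 0 <= l.
Proof.
move=> ul u0; suff -> : l = `|l| by [].
apply: (norm_cvg_unique ul).
have -> : u = (fun n => `|u n|) by apply/funext => n; rewrite ger0_norm.
exact: cvg_norm.
Qed.

Lemma cvgn_le (u v : nat -> K) l m :
  u n @[n --> \oo] --> l -> v n @[n --> \oo] --> m ->
  (forall n, u n <= v n) -> l <= m.
Proof.
move=> ul vm uv; rewrite -subr_ge0; apply: (@cvgn_ge0 (v - u)).
  exact: cvgB.
by move=> n; rewrite subr_ge0.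
Qed.
End Limits.

(** * Inner product *)

Section Dot.
Context {R : realType} {k : scalar_kind} {H : normedModType (scalar R k)}.
Context {dot : {dot H for sconj R k}}.
Hypothesis normE : norm_induced_by dot.
Local Notation conj := (sconj R k).

Lemma normr_sqr_dot z : `|z| ^+ 2 = dot z z.
Proof.
rewrite normE sqr_ssqrt //; have [->|/neq0_dnorm_gt0/ltW//] := eqVneq z 0.
by rewrite linear0l.
Qed.

Lemma normrB_sqr_dot u v :
  `|u - v| ^+ 2 = `|u| ^+ 2 + `|v| ^+ 2 - (dot u v + conj (dot u v)).
Proof. by rewrite !normr_sqr_dot hnormB /= expr0 mul1r. Qed.

(** The squared norm of [u - (dot u v / `|v| ^+ 2) *: v], the component of [u]
    orthogonal to [v], is [`|u| ^+ 2 - `|dot u v| ^+ 2 / `|v| ^+ 2]. *)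
Lemma dot_Cauchy_Schwarz u v : `|dot u v| <= `|u| * `|v|.
Proof.
have [->|v0] := eqVneq v 0; first by rewrite linear0r !normr0 mulr0.
have nv0 : 0 < `|v| ^+ 2 by rewrite exprn_gt0 // normr_gt0.
set a := dot u v.
have nvC : conj (`|v| ^+ 2)^-1 = (`|v| ^+ 2)^-1.
  by rewrite sconj_id // ger0_real // invr_ge0 ltW.
have := exprn_ge0 2 (normr_ge0 (u - (a / `|v| ^+ 2) *: v)).
rewrite normrB_sqr_dot normrZ linearZr_LR /= -/a !rmorphM /= sconjK nvC.
rewrite normrM normfV (ger0_norm (ltW nv0)).
have aaE : conj a * a = `|a| ^+ 2 by rewrite mulrC mulr_sconj.
have -> : conj a / `|v| ^+ 2 * a = `|a| ^+ 2 / `|v| ^+ 2 by rewrite mulrAC aaE.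
have -> : a * conj (`|v| ^- 2) * conj a = `|a| ^+ 2 / `|v| ^+ 2.
  by rewrite nvC mulrAC mulr_sconj.
have -> : (`|a| / `|v| ^+ 2 * `|v|) ^+ 2 = `|a| ^+ 2 / `|v| ^+ 2.
  by rewrite !exprMn -mulrA (expr2 (_^-1)) mulfVK ?gt_eqF.
rewrite addrKA subr_ge0 ler_pdivrMr // -exprMn ler_pXn2r // nnegrE.
by rewrite mulr_ge0.
Qed.

Lemma cvg_dotr x (v : nat -> H) w :
  v n @[n --> \oo] --> w -> dot x (v n) @[n --> \oo] --> dot x w.
Proof.
move=> vw; apply/cvgrPdist_lt => eps eps0.
(* [`|x| + 1] rather than [`|x|], which may vanish. *)
have x1 : 0 < `|x| + 1 by rewrite ltr_wpDl.
move/cvgrPdist_lt : vw => /(_ (eps / (`|x| + 1)) (divr_gt0 eps0 x1)).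
apply: filterS => n; rewrite ltr_pdivlMr // => wn.
rewrite -linearBr /= (le_lt_trans (dot_Cauchy_Schwarz _ _)) //.
by rewrite (le_lt_trans _ wn) // mulrC ler_wpM2l // lerDl.
Qed.

(** A ball around [y] of radius less than [`|y|] misses [0], which is what makes
    a bound opposite to Cauchy-Schwarz possible on it. *)
Lemma reverse_Schwarz (x y : H) (r : scalar R k) :
  `|x - y| <= r -> r ^+ 2 < `|y| ^+ 2 ->
  `|x| ^+ 2 <= sRe (dot x y) ^+ 2 / (`|y| ^+ 2 - r ^+ 2).
Proof.
move=> xy ry; set D := `|y| ^+ 2 - r ^+ 2; set c := sRe _.
have D0 : 0 < D by rewrite subr_gt0.
have X0 : 0 <= `|x| ^+ 2 by rewrite exprn_ge0.
(* The hypothesis [`|x - y| ^+ 2 <= r ^+ 2], expanded. *)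
have XD : `|x| ^+ 2 + D <= c *+ 2.
  have : `|x - y| ^+ 2 <= r ^+ 2 by rewrite lerXn2r // nnegrE ?(le_trans _ xy).
  rewrite normrB_sqr_dot addr_sconj mulr_natl lerBlDr => xyr.
  by rewrite addrA lerBlDl.
rewrite ler_pdivlMr // -(ler_pMn2r (isT : 0 < 4)%N).
have : (`|x| ^+ 2 + D) ^+ 2 <= (c *+ 2) ^+ 2.
  have s0 : 0 <= `|x| ^+ 2 + D by rewrite addr_ge0 // ltW.
  by rewrite lerXn2r // nnegrE // (le_trans s0).
(* What remains is [4 * `|x| ^+ 2 * D <= (`|x| ^+ 2 + D) ^+ 2]. *)
rewrite exprMn_n; apply: le_trans.
by rewrite real_leif_AGM2_scaled // ger0_real // ltW.
Qed.
End Dot.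

(** * Orthonormal families *)

Section Orthonormal.
Context {R : realType} {k : scalar_kind}.
Context {H : completeNormedModType (scalar R k)}.
Context {dot : {dot H for sconj R k}}.
Hypothesis normE : norm_induced_by dot.
Context {e : nat -> H}.
Hypothesis one : orthonormal_family dot e.
Local Notation conj := (sconj R k).

Lemma dot_sumr x (b : nat -> scalar R k) s :
  dot x (\sum_(i <- s) b i *: e i) = \sum_(i <- s) conj (b i) * dot x (e i).
Proof. by rewrite linear_sumr; apply: eq_bigr => i _; rewrite linearZr_LR. Qed.

Lemma dot_suml_e (a : nat -> scalar R k) s j : uniq s -> j \in s ->
  dot (\sum_(i <- s) a i *: e i) (e j) = a j.
Proof.
case: one => eo e1 us js; rewrite linear_sumlz /= (bigD1_seq j) //=.
rewrite linearZl_LR /= -normr_sqr_dot // e1 expr1n mulr1 big1 ?addr0 // => i ij.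
by rewrite linearZl_LR /= eo // mulr0.
Qed.

Lemma dot_sum (a b : nat -> scalar R k) s : uniq s ->
  dot (\sum_(i <- s) a i *: e i) (\sum_(i <- s) b i *: e i) =
  \sum_(i <- s) conj (b i) * a i.
Proof.
move=> us; rewrite dot_sumr big_seq [RHS]big_seq; apply: eq_bigr => j js.
by rewrite dot_suml_e.
Qed.

Lemma normr_sqr_sum (a : nat -> scalar R k) s : uniq s ->
  `|\sum_(i <- s) a i *: e i| ^+ 2 = \sum_(i <- s) `|a i| ^+ 2.
Proof.
move=> us; rewrite (normr_sqr_dot normE) dot_sum //.
by apply: eq_bigr => i _; rewrite mulrC mulr_sconj.
Qed.

(** The difference of the two sides is the squared norm of the component
    of [x] orthogonal to the [e i]. *)
Lemma Bessel_ineq x s : uniq s ->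
  \sum_(i <- s) `|dot x (e i)| ^+ 2 <= `|x| ^+ 2.
Proof.
move=> us; set B := \sum_(i <- s) _.
have B0 : 0 <= B by apply: sumr_ge0 => i _; rewrite exprn_ge0.
rewrite -subr_ge0.
have := exprn_ge0 2 (normr_ge0 (x - \sum_(i <- s) dot x (e i) *: e i)).
rewrite (normrB_sqr_dot normE) normr_sqr_sum // dot_sumr.
under [X in _ - (X + _)]eq_bigr do rewrite mulrC mulr_sconj.
under [X in _ - (_ + conj X)]eq_bigr do rewrite mulrC mulr_sconj.
by rewrite -/B (sconj_id _ (ger0_real B0)) addrKA.
Qed.

(** By Pythagoras the squared norms of the blocks of this series are the blocks
    of the series of squares, which is Cauchy; [H] is complete. *)
Lemma is_cvg_series_orthonormal (a : nat -> scalar R k) :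
  square_summable a -> cvgn (series (fun i => a i *: e i)).
Proof.
move=> /cvg_cauchy/cauchy_seriesP ca.
apply/cauchy_cvgP/cauchy_seriesP => eps eps0.
apply: filterS (ca _ (exprn_gt0 2 eps0)) => -[m n] /=.
rewrite ger0_norm; last by apply: sumr_ge0 => i _; rewrite exprn_ge0.
by rewrite -normr_sqr_sum ?iota_uniq // ltr_pXn2r // nnegrE ?normr_ge0 ?ltW.
Qed.

Lemma normr_sqr_series_orthonormal (a : nat -> scalar R k) :
  square_summable a ->
  `|limn (series (fun i => a i *: e i))| ^+ 2 =
  limn (series (fun i => `|a i| ^+ 2)).
Proof.
move=> sa; have acvg := is_cvg_series_orthonormal a sa.
apply: (norm_cvg_unique _ sa).
have -> : series (fun i => `|a i| ^+ 2) =
    (fun n => `|series (fun i => a i *: e i) n| ^+ 2).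
  by apply/funext => n; rewrite normr_sqr_sum ?iota_uniq.
exact: cvgM (cvg_norm acvg) (cvg_norm acvg).
Qed.

Lemma cvg_dot_series x (a : nat -> scalar R k) :
  square_summable a ->
  series (fun i => conj (a i) * dot x (e i)) n @[n --> \oo] -->
    dot x (limn (series (fun i => a i *: e i))).
Proof.
move=> sa; under eq_fun do rewrite /series /= -dot_sumr.
by apply: cvg_dotr => //; exact: is_cvg_series_orthonormal.
Qed.

(** The partial sums are monotone and, by Bessel's inequality, bounded. *)
Lemma square_summable_dot x : square_summable (fun i => dot x (e i)).
Proof.
apply: (@nondecreasing_bounded_is_cvgn _ _ _ (`|x| ^+ 2)).
- by move=> n; apply: sumr_ge0 => i _; rewrite exprn_ge0.
- by apply/nondecreasing_seqP => n; rewrite seriesSr lerDl exprn_ge0.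
- by move=> n; apply: Bessel_ineq; rewrite iota_uniq.
Qed.

Lemma Bessel_series_ineq x :
  limn (series (fun i => `|dot x (e i)| ^+ 2)) <= `|x| ^+ 2.
Proof.
apply: (cvgn_le _ _ _ _ (square_summable_dot x) (cvg_cst _)) => n.
by apply: Bessel_ineq; rewrite iota_uniq.
Qed.

(** The inner product on the left is the limit of the inner products of the
    partial sums of [dot x (e i) *: e i] and [a i *: e i].  Applying
    Cauchy-Schwarz to these, and not to [x] and the sum of the series, is what
    gives the factor [\sum `|dot x (e i)| ^+ 2] in place of [`|x| ^+ 2]. *)
Lemma dot_series_Cauchy_Schwarz x (a : nat -> scalar R k) :
  square_summable a ->
  `|dot x (limn (series (fun i => a i *: e i)))| ^+ 2 <=
  limn (series (fun i => `|a i| ^+ 2)) *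
  limn (series (fun i => `|dot x (e i)| ^+ 2)).
Proof.
move=> sa.
have dcvg := cvg_norm (FF := eventually_filter) (cvg_dot_series x a sa).
rewrite [X in X <= _]expr2.
apply: (cvgn_le _ _ _ _ (cvgM dcvg dcvg)
          (cvgM sa (square_summable_dot x))) => n /=.
rewrite /series /= -(dot_sum (fun i => dot x (e i)) a) ?iota_uniq //.
rewrite -!normr_sqr_sum ?iota_uniq // -expr2 -exprMn mulrC.
by rewrite ler_pXn2r ?nnegrE ?mulr_ge0 // dot_Cauchy_Schwarz.
Qed.
End Orthonormal.

(** * Reverse of the Schwarz inequality along an orthonormal family *)

Theorem theorem5 (R : realType) (k : scalar_kind)
    (H : completeNormedModType (scalar R k)) (dot : {dot H for sconj R k})
    (e : nat -> H) (lambda : nat -> scalar R k) (r : scalar R k) (x : H) :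
  norm_induced_by dot ->
  infinite_dimensional H ->
  orthonormal_family dot e ->
  square_summable lambda ->
  0 < r ->
  let L := limn (series (fun i => `|lambda i| ^+ 2)) in
  r ^+ 2 < L ->
  `|x - limn (series (fun i => lambda i *: e i))| <= r ->
  let A := limn (series (fun i => sconj R k (lambda i) * dot x (e i))) in
  let C := limn (series (fun i => sRe (sconj R k (lambda i) * dot x (e i)))) in
  let B := limn (series (fun i => `|dot x (e i)| ^+ 2)) in
  [/\ `|x| ^+ 2 <= C ^+ 2 / (L - r ^+ 2),
      C ^+ 2 / (L - r ^+ 2) <= `|A| ^+ 2 / (L - r ^+ 2) &
      `|A| ^+ 2 / (L - r ^+ 2) <= L / (L - r ^+ 2) * B]
  /\ (0 <= `|x| ^+ 2 - B /\ `|x| ^+ 2 - B <= r ^+ 2 / (L - r ^+ 2) * B).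
Proof.
move=> normE _ one sq r0 L rL; set S := limn _ => xS A C B.
have AE : A = dot x S by apply: norm_cvg_lim; exact: cvg_dot_series.
have CE : C = sRe A.
  apply: norm_cvg_lim; apply: cvg_series_sRe; rewrite AE.
  exact: cvg_dot_series.
have SL : `|S| ^+ 2 = L by exact: normr_sqr_series_orthonormal.
have BX : B <= `|x| ^+ 2 by exact: Bessel_series_ineq.
have ALB : `|A| ^+ 2 <= L * B.
  by rewrite AE; exact: dot_series_Cauchy_Schwarz.
have D0 : 0 < L - r ^+ 2 by rewrite subr_gt0.
have XC : `|x| ^+ 2 <= C ^+ 2 / (L - r ^+ 2).
  by rewrite CE AE -SL; apply: reverse_Schwarz => //; rewrite SL.
have CA : C ^+ 2 / (L - r ^+ 2) <= `|A| ^+ 2 / (L - r ^+ 2).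
  rewrite ler_pM2r ?invr_gt0 // CE -real_normK ?sRe_is_real //.
  by rewrite ler_pXn2r ?nnegrE // norm_sRe.
have AB : `|A| ^+ 2 / (L - r ^+ 2) <= L / (L - r ^+ 2) * B.
  by rewrite [leRHS]mulrAC ler_pM2r ?invr_gt0.
split; first by split.
split; first by rewrite subr_ge0.
rewrite lerBlDr (le_trans XC) // (le_trans CA) // (le_trans AB) //.
have -> : L / (L - r ^+ 2) = r ^+ 2 / (L - r ^+ 2) + 1.
  by rewrite -{1}[L](subrKC (r ^+ 2)) mulrDl divff ?lt0r_neq0.
by rewrite mulrDl mul1r.
Qed.
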